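(* Let $G$ be an $h$-perfect finite simple graph with vertex set $[n]=\{1,\dots,n\}$, $n\ge1$, and let $\mathcal{P}_G\subset\mathbb{R}^n$ be its stable set polytope. Then $$\operatorname{codeg}(\mathcal{P}_G)=\omega(G)+1,$$ where $\omega(G)$ denotes the clique number of $G$.
   Context: A stable set of $G$ is a subset $S\subset[n]$ such that no two distinct elements of $S$ are adjacent. The stable set polytope is $\mathcal{P}_G=\operatorname{conv}\{\mathbf{e}_S : S\text{ a stable set of }G\}\subset\mathbb{R}^n$, where $\mathbf{e}_S=\sum_{i\in S}\mathbf{e}_i$ is the indicator vector of $S$; it is a full-dimensional lattice polytope. $G$ is called $h$-perfect if $\mathcal{P}_G$ is exactly the set of $x\in\mathbb{R}^n$ satisfying: $x_i\ge 0$ for all $i\in[n]$; $\sum_{i\in Q}x_i\le 1$ for every clique $Q$ of $G$ (set of pairwise adjacent vertices); and $\sum_{i\in C}x_i\le \frac{|C|-1}{2}$ for (the vertex set of) every odd cycle $C$ of $G$. For a full-dimensional lattice polytope $\mathcal{P}\subset\mathbb{R}^n$ (a convex polytope all of whose vertices have integer coordinates), the codegree $\operatorname{codeg}(\mathcal{P})$ is the smallest positive integer $k$ such that the interior of the dilate $k\mathcal{P}$ contains a point of $\mathbb{Z}^n$. The clique number $\omega(G)$ is the maximal cardinality of a clique of $G$. *)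

(* Defs.v *)
From mathcomp Require Import all_boot all_order all_algebra.
From mathcomp Require Import boolp classical_sets reals topology normedtype convex.

Set Implicit Arguments.
Unset Strict Implicit.
Unset Printing Implicit Defensive.

Import Order.TTheory GRing.Theory Num.Theory.
Import numFieldNormedType.Exports.

Local Open Scope classical_set_scope.
Local Open Scope ring_scope.

(* A graph on [n] is given by its adjacency relation [e : rel 'I_n]; symmetry
   and irreflexivity are hypotheses of the theorem. *)
Section Graphs.
Variables (n : nat) (e : rel 'I_n).

Definition stable_set (S : {set 'I_n}) : bool :=
  [forall i in S, forall j in S, (i != j) ==> ~~ e i j].

Definition clique (Q : {set 'I_n}) : bool :=
  [forall i in Q, forall j in Q, (i != j) ==> e i j].

Definition clique_number : nat := (\max_(Q : {set 'I_n} | clique Q) #|Q|)%N.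

(* [c] lists the vertices of the cycle in cyclic order, without repetition.
   Chords are allowed, and triangles count as odd cycles. *)
Definition odd_cycle (c : seq 'I_n) : bool :=
  [&& (2 < size c)%N, odd (size c) & ucycleb e c].

End Graphs.

Section Polytopes.
Variables (R : realType) (n : nat).

Definition convex_hull (A : set 'rV[R]_n) : set 'rV[R]_n :=
  smallest (fun B : set 'rV[R]_n => convex_set B) A.

Definition indicator (S : {set 'I_n}) : 'rV[R]_n :=
  \sum_(i in S) delta_mx 0 i.

Definition stable_set_polytope (e : rel 'I_n) : set 'rV[R]_n :=
  convex_hull [set indicator S | S in [set S | stable_set e S]].

Definition h_perfect (e : rel 'I_n) : Prop :=
  stable_set_polytope e =
  [set x | [/\ forall i, 0 <= x 0 i,
               forall Q : {set 'I_n}, clique e Q -> \sum_(i in Q) x 0 i <= 1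
             & forall c : seq 'I_n, odd_cycle e c ->
                 \sum_(i <- c) x 0 i <= ((size c)%:R - 1) / 2]].

Definition dilate (k : nat) (P : set 'rV[R]_n) : set 'rV[R]_n :=
  [set k%:R *: x | x in P].

Definition has_interior_lattice_point (P : set 'rV[R]_n) : Prop :=
  exists z : 'rV[int]_n, (interior P) (map_mx intr z).

(* The least element of the set of admissible dilation factors; the junk value
   0 is returned only when that set is empty, which never happens for a
   full-dimensional polytope. *)
Definition codegree (P : set 'rV[R]_n) : nat :=
  let K := [set k | (0 < k)%N /\ has_interior_lattice_point (dilate k P)] in
  xget 0%N [set k | K k /\ forall j, K j -> (k <= j)%N].

End Polytopes.

Arguments indicator R {n} S.
Arguments stable_set_polytope R {n} e.
Arguments h_perfect R {n} e.

(* Main.v *)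
Require Import Defs.
From mathcomp Require Import all_boot all_order all_algebra.
From mathcomp Require Import boolp classical_sets reals topology normedtype convex.
From mathcomp Require Import zify ring lra.

(** The dilate [k P_G] is cut out by the inequalities of [h_perfect] with
    right-hand sides multiplied by [k], and every lattice point [z] in its
    interior satisfies them strictly.

    In particular all [z_i] are positive integers, so the inequality of a clique
    [Q] of maximal size gives [omega <= \sum_(i in Q) z_i < k]: this is
    [interior_lattice_point_gt].

    Conversely the all-ones vector is interior to [(omega + 1) P_G]. It has slack
    in every clique inequality since a clique has at most [omega] vertices. For
    an odd cycle of length [l] the required bound [l < (omega + 1) (l - 1) / 2]
    only has to be checked for small [omega]: a cycle contains an edge, so
    [omega >= 2]; if [omega = 2] there is no triangle, so [l >= 5] and
    [l < 3 (l - 1) / 2]; and if [omega >= 3] then [l < 2 (l - 1)]. This is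
    [odd_cycle_slack]. As all quantities are integers, the slack is bounded below
    by [1 / 2], which makes a cube of side [1 / n] around the all-ones vector fit
    into the dilate ([ones_interior]). *)

Set Implicit Arguments.
Unset Strict Implicit.
Unset Printing Implicit Defensive.

Import Order.TTheory GRing.Theory Num.Theory.
Import numFieldNormedType.Exports.

Local Open Scope classical_set_scope.
Local Open Scope ring_scope.

Lemma cliqueP (n : nat) (e : rel 'I_n) (Q : {set 'I_n}) :
  reflect {in Q &, forall i j, i != j -> e i j} (clique e Q).
Proof.
apply: (iffP idP) => [cQ i j iQ jQ ij|cQ].
  by have /forall_inP/(_ i iQ)/forall_inP/(_ j jQ)/implyP := cQ; apply.
apply/forall_inP => i iQ; apply/forall_inP => j jQ; apply/implyP; exact: cQ.
Qed.

Lemma clique_leq_clique_number (n : nat) (e : rel 'I_n) (Q : {set 'I_n}) :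
  clique e Q -> (#|Q| <= clique_number e)%N.
Proof. by move=> cQ; rewrite /clique_number; apply: leq_bigmax_cond. Qed.

Lemma clique_number_attained (n : nat) (e : rel 'I_n) :
  exists2 Q : {set 'I_n}, clique e Q & #|Q| = clique_number e.
Proof.
have c0 : clique e finset.set0 by apply/cliqueP => i j; rewrite inE.
have [|Q cQ max_Q] := @eq_bigmax_cond _ (clique e) (fun Q => #|Q|).
  by apply/card_gt0P; exists finset.set0.
by exists Q.
Qed.

Lemma edge_clique_number (n : nat) (e : rel 'I_n) (i j : 'I_n) :
  symmetric e -> irreflexive e -> e i j -> (2 <= clique_number e)%N.
Proof.
move=> e_sym e_irr eij.
have ij : i != j by apply: contraTN eij => /eqP ->; rewrite e_irr.
have <- : #|[set i; j]%SET| = 2%N by rewrite cards2 ij.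
apply: clique_leq_clique_number; apply/cliqueP => x y.
by rewrite !inE => /orP[] /eqP -> /orP[] /eqP -> //; rewrite ?eqxx // e_sym.
Qed.

Lemma triangle_clique_number (n : nat) (e : rel 'I_n) (i j k : 'I_n) :
  symmetric e -> ucycleb e [:: i; j; k] -> (3 <= clique_number e)%N.
Proof.
move=> e_sym /andP[/= /and4P[eij ejk eki _] u].
have <- : #|[set x in [:: i; j; k]]%SET| = 3%N by rewrite cardsE; apply/card_uniqP.
apply: clique_leq_clique_number; apply/cliqueP => x y.
rewrite !inE => /or3P[] /eqP -> /or3P[] /eqP -> //;
  by rewrite ?eqxx // e_sym.
Qed.

(** The gap of one comes from integrality: without denominators the point is
    [2 l < (omega + 1) (l - 1)]. As an edge of the cycle gives [omega >= 2], this
    could only fail for [l = 3] and [omega = 2], which a triangle excludes. *)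
Lemma odd_cycle_slack (n : nat) (e : rel 'I_n) (c : seq 'I_n) :
  symmetric e -> irreflexive e -> odd_cycle e c ->
  (2 * size c + 1 <= (clique_number e + 1) * (size c - 1))%N.
Proof.
move=> e_sym e_irr; case: c => [|i [|j [|k c]]] // /and3P[_ odd_c cyc].
have eij : e i j by move: cyc => /andP[/= /andP[]].
have := edge_clique_number e_sym e_irr eij.
case: c odd_c cyc => [_|l [|m c]] //= cyc.
  by have /= := triangle_clique_number e_sym cyc; nia.
by nia.
Qed.

Lemma dilate_h_perfectP (R : realType) (n : nat) (e : rel 'I_n) (k : nat)
    (y : 'rV[R]_n) :
  h_perfect R e -> (0 < k)%N ->
  dilate k (stable_set_polytope R e) y <->
  [/\ forall i, 0 <= y 0 i,
      forall Q : {set 'I_n}, clique e Q -> \sum_(i in Q) y 0 i <= k%:R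
    & forall c : seq 'I_n, odd_cycle e c ->
        \sum_(i <- c) y 0 i <= k%:R * (((size c)%:R - 1) / 2)].
Proof.
move=> e_hperf k_gt0; rewrite /dilate e_hperf.
have k0 : 0 < k%:R :> R by rewrite ltr0n.
have sumZ (x : 'rV[R]_n) (r : seq 'I_n) (P : pred 'I_n) (a : R) :
    \sum_(i <- r | P i) (a *: x) 0 i = a * \sum_(i <- r | P i) x 0 i.
  by rewrite mulr_sumr; apply: eq_bigr => i _; rewrite mxE.
split=> [[x [x0 xQ xC] <-]|[y0 yQ yC]].
  split=> [i|Q cQ|c oc]; first by rewrite mxE mulr_ge0 // ltW.
    by rewrite sumZ ger_pMr // xQ.
  by rewrite sumZ ler_pM2l // xC.
exists (k%:R^-1 *: y); last by rewrite scalerA divff ?scale1r // gt_eqF.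
split=> [i|Q cQ|c oc]; first by rewrite mxE mulr_ge0 // invr_ge0 ltW.
  by rewrite sumZ ler_pdivrMl // mulr1 yQ.
by rewrite sumZ ler_pdivrMl // yC.
Qed.

(** Positivity of the integers [z_i] gives [z_i >= 1], so a maximum clique
    already weighs [omega] at an interior lattice point [z]. *)
Lemma interior_lattice_point_gt (R : realType) (n : nat) (e : rel 'I_n) (k : nat) :
  h_perfect R e -> (0 < k)%N ->
  has_interior_lattice_point (dilate k (stable_set_polytope R e)) ->
  (clique_number e < k)%N.
Proof.
move=> e_hperf k_gt0 [z /nbhs_ballP[eps /= eps0 zP]].
have e20 : 0 < eps / 2 by rewrite divr_gt0.
(* Both translates of [z] along the all-ones vector stay in the dilate, which
   makes all of its inequalities strict at [z] at once. *)
pose shift (t : R) : 'rV[R]_n := map_mx intr z + const_mx t.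
have shiftP t : `|t| < eps ->
    dilate k (stable_set_polytope R e) (shift t).
  move=> t_eps; apply: zP; split=> // i j; rewrite /ball /= !mxE.
  by rewrite opprD addNKr normrN.
have e2_lt : eps / 2 < eps by rewrite ltr_pdivrMr // ltr_pMr // ltr1n.
have z_ge1 i : 1 <= (z 0 i)%:~R :> R.
  have /(dilate_h_perfectP _ e_hperf k_gt0)[/(_ i) zi _ _] :
    dilate k (stable_set_polytope R e) (shift (- (eps / 2))).
    by apply: shiftP; rewrite normrN gtr0_norm.
  have : 0 < (z 0 i)%:~R :> R by move: zi; rewrite !mxE; lra.
  by rewrite ltr0z gtz0_ge1 ler1z.
have [Q cQ <-] := clique_number_attained e.
have [->//|Q_gt0] := posnP #|Q|.
have /(dilate_h_perfectP _ e_hperf k_gt0)[_ /(_ Q cQ) zQ _] :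
  dilate k (stable_set_polytope R e) (shift (eps / 2)).
  by apply: shiftP; rewrite gtr0_norm.
rewrite -(ltr_nat R); apply: lt_le_trans zQ.
apply: (@lt_le_trans _ _ (\sum_(i in Q) (1 + eps / 2))).
  by rewrite sumr_const ltr_pMn2r //; lra.
by apply: ler_sum => i _; rewrite !mxE lerD2r.
Qed.

Lemma ones_interior (R : realType) (n : nat) (e : rel 'I_n) :
  (0 < n)%N -> symmetric e -> irreflexive e -> h_perfect R e ->
  has_interior_lattice_point
    (dilate (clique_number e + 1) (stable_set_polytope R e)).
Proof.
move=> n_gt0 e_sym e_irr e_hperf; exists (const_mx 1).
have n0 : 0 < n%:R :> R by rewrite ltr0n.
have n1 : 1 <= n%:R :> R by rewrite ler1n.
(* Sums of at most [n] entries move by at most [1 / 2], the smallest slack. *)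
pose eps : R := (2 * n%:R)^-1.
have eps0 : 0 < eps by rewrite invr_gt0 mulr_gt0.
have epsn : n%:R * eps = 1 / 2 by rewrite /eps; field; lra.
apply/nbhs_ballP; exists eps => //= y [_ y_ball].
have y_near i : `|1 - y 0 i| < eps.
  by have := y_ball 0 i; rewrite /ball /= !mxE.
have ysum (Q : {set 'I_n}) : \sum_(i in Q) y 0 i <= #|Q|%:R + 1 / 2.
  apply: (@le_trans _ _ (\sum_(i in Q) (1 + eps))).
    by apply: ler_sum => i _; have := y_near i; rewrite ltr_norml; lra.
  rewrite sumr_const mulrnDl lerD2l -epsn -[leLHS]mulr_natl ler_pM2r // ler_nat.
  by rewrite -[leqRHS]card_ord max_card.
apply/dilate_h_perfectP => //; first by rewrite addn1.
split=> [i|Q cQ|c oc].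
- have := y_near i; rewrite ltr_norml.
  have : eps <= 1 / 2 by rewrite -epsn ler_peMl // ltW.
  by lra.
- apply: le_trans (ysum Q) _; rewrite natrD.
  have : #|Q|%:R <= (clique_number e)%:R :> R.
    by rewrite ler_nat clique_leq_clique_number.
  by lra.
- have /and3P[size_c _ /andP[_ uniq_c]] := oc.
  have -> : \sum_(i <- c) y 0 i = \sum_(i in [set i in c]%SET) y 0 i.
    by rewrite big_uniq //=; apply: eq_bigl => i; rewrite inE.
  apply: le_trans (ysum _) _; rewrite cardsE (card_uniqP uniq_c).
  have := odd_cycle_slack e_sym e_irr oc.
  rewrite -(ler_nat R) natrD !natrM natrB; last by lia.
  by lra.
Qed.

Theorem theorem1p3 (R : realType) (n : nat) (e : rel 'I_n)
    (n_gt0 : (0 < n)%N) (e_sym : symmetric e) (e_irr : irreflexive e)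
    (e_hperf : h_perfect R e) :
  codegree (stable_set_polytope R e) = (clique_number e + 1)%N.
Proof.
have ones : has_interior_lattice_point
  (dilate (clique_number e + 1) (stable_set_polytope R e)).
  exact: ones_interior.
have lower k : (0 < k)%N ->
    has_interior_lattice_point (dilate k (stable_set_polytope R e)) ->
    (clique_number e + 1 <= k)%N.
  by move=> k_gt0; rewrite addn1; apply: interior_lattice_point_gt.
apply: xget_unique.
  by split=> [|j [j_gt0 /(lower j j_gt0)]//]; split; first by rewrite addn1.
move=> k [[k_gt0 /(lower k k_gt0) w_le] k_min]; apply/eqP.
by rewrite eqn_leq w_le k_min // addn1; split; last by rewrite -addn1.
Qed.
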